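(* Let $\mathbf A_{\mathcal I}$, $\mathbf L$, $\mathbf f$ be the incidence matrix, length matrix and right-hand side vector associated with the unit mesh $\Gamma_Y$, as defined in the context. Then the linear system $$\begin{bmatrix}\mathbf L&\mathbf A_{\mathcal I}^T\\ \mathbf A_{\mathcal I}&\mathbf 0\end{bmatrix}\begin{bmatrix}\mathbf b\\ \mathbf Q\end{bmatrix}=\begin{bmatrix}\mathbf f\\ \mathbf 0\end{bmatrix}$$ for $\mathbf b=(\mathbf b_1^T,\dots,\mathbf b_{N_{\mathcal E}}^T)^T\in\mathbb R^{2N_{\mathcal E}}$ and $\mathbf Q=(\mathbf Q_1^T,\dots,\mathbf Q_{N_{\mathcal V'}}^T)^T\in\mathbb R^{2N_{\mathcal V'}}$ uniquely defines $\mathbf b$, and consequently it uniquely defines the homogenized tensor $\mathbf A_{\rm hom}$.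
   Context: Let $e_1=(1,0)$, $e_2=(0,1)$. The unit mesh $\Gamma_Y\subset[0,1]^2$ is a one-dimensional manifold described by a connected oriented graph with vertex set $\mathcal V$ and $N_{\mathcal E}$ edges; the $j$-th edge has length $\ell_j$ and a bijective $W^{1,\infty}$ arc length parametrization $\gamma_j$ directed according to its orientation, with start vertex $\gamma_j(0)$ and end vertex $\gamma_j(\ell_j)$; $\mathbf t=\gamma_j'\circ\gamma_j^{-1}$ is the unit tangent vector. It is assumed that there are $y_1,y_2\in\Gamma_Y$ with $y_1+e_1,\,y_2+e_2\in\Gamma_Y$. The periodic graph $\Gamma_{Y,\#}$ is obtained from $\Gamma_Y$ by identifying opposite points on the sides of $[0,1]^2$, i.e. $y$ with $y+e_1$ and $y$ with $y+e_2$ for points on $\partial[0,1]^2$, and by identifying all corner points of $[0,1]^2$ belonging to $\Gamma_Y$. $\mathcal V'$ is the set of all vertices of $\Gamma_Y$ not located on the right and upper boundary of the unit cell $[0,1]^2$, $N_{\mathcal V'}$ is their number, and they are indexed as the first $N_{\mathcal V'}$ vertices $v_1,\dots,v_{N_{\mathcal V'}}$ of $\mathcal V$. For a vertex $v\in\mathcal V$, $\eta(v)\in\mathbb R^2$ equals $e_1$ or $e_2$ if $v$ lies on the right or top side of the unit cell (excluding the corners), respectively, equals $e_1+e_2$ if $v$ lies on the right top corner, and equals $\mathbf 0$ otherwise. $\mathbf A_{\mathcal I}\in\mathbb R^{2N_{\mathcal V'}\times 2N_{\mathcal E}}$ is the incidence matrix of the oriented periodic graph: the $2\times2$ submatrix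 on the intersection of rows $2i-1,2i$ and columns $2j-1,2j$ is $\mathbf I_2$ if the $j$-th edge enters the $i$-th vertex ($\gamma_j(\ell_j)=v_i$), $-\mathbf I_2$ if the $j$-th edge leaves the $i$-th vertex ($\gamma_j(0)=v_i$), and $\mathbf 0$ otherwise, where vertices are understood in the periodic graph (opposite points identified) and for an edge that is a loop in the periodic graph the two contributions cancel. $\mathbf L\in\mathbb R^{2N_{\mathcal E}\times 2N_{\mathcal E}}$ is the diagonal matrix whose $(2j-1)$-th and $2j$-th diagonal entries equal $\ell_j$. $\mathbf f\in\mathbb R^{2N_{\mathcal E}}$ has as $(2j-1)$-th and $2j$-th components the first and second components of $\eta(\gamma_j(\ell_j))-\eta(\gamma_j(0))$. The homogenized tensor is $\mathbf A_{\rm hom}=\frac1{|\Gamma_Y|}\int_{\Gamma_Y}(\mathbf t+\partial_\Gamma\phi)(\mathbf t+\partial_\Gamma\phi)^T\,ds$, where $\phi\in H^1_\#(\Gamma_Y)^2$ is an arbitrary solution of the canonical problem $\int_{\Gamma_Y}\partial_\Gamma\phi\,\partial_\Gamma\psi\,ds=-\int_{\Gamma_Y}\mathbf t\,\partial_\Gamma\psi\,ds$ for all $\psi\in H^1_\#(\Gamma_Y)$. Here $\partial_\Gamma u=\frac{d}{ds}(u\circ\gamma_j)$ on the $j$-th edge, integrals over $\Gamma_Y$ are sums over the edges of curve integrals of the first kind, $|\Gamma_Y|=\int_{\Gamma_Y}ds$, and $H^1_\#(\Gamma_Y)$ is the space of $u\in L^2(\Gamma_Y)$ with $\partial_\Gamma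 u\in L^2(\Gamma_Y)$ that are continuous on the periodic graph $\Gamma_{Y,\#}$. The unknowns of the system stand for the following quantities: with $\mathbf q(x)=\phi(x)+x$ on $\Gamma_Y$ (which is affine in arc length along each edge), $\mathbf b_j=\frac{d}{ds}(\mathbf q\circ\gamma_j)\in\mathbb R^2$ for $j=1,\dots,N_{\mathcal E}$ and $\mathbf Q_i=\mathbf q(v_i)\in\mathbb R^2$ for $i=1,\dots,N_{\mathcal V'}$.
   Formalization: η is taken to be e_1 at corner (1,0) and e_2 at (0,1) (the text's 0 there makes the A_hom claim false), and it is made explicit that every vertex has a representative in V' and that interior edge points are identified only when whole edges are. *)

(* Defs.v *)
From HB Require Import structures.
From mathcomp Require Export all_boot all_order all_algebra.
From mathcomp Require Export all_classical all_reals all_analysis.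

Set Implicit Arguments.
Unset Strict Implicit.
Unset Printing Implicit Defensive.

Import Order.TTheory GRing.Theory Num.Theory.
Import numFieldNormedType.Exports.

Local Open Scope classical_set_scope.
Local Open Scope ring_scope.

Section UnitCell.
Variable R : realType.

Definition e (k : 'I_2) : 'cV[R]_2 := delta_mx k 0.

Definition right_top (y : 'cV[R]_2) : bool := [exists k, y k 0 == 1].
Definition corner (y : 'cV[R]_2) : bool :=
  [forall k, (y k 0 == 0) || (y k 0 == 1)].

(* Two points of the closed unit cell represent the same point of the periodic
   graph. When y and y + e k both lie in [0,1]^2 they are automatically opposite
   points of the boundary. *)
Definition per_eq (y z : 'cV[R]_2) : bool :=
  [|| y == z,
      [exists k, (z == y + e k) || (y == z + e k)]
    | corner y && corner z].

(* e_1 on the right side, e_2 on the top side, e_1 + e_2 at the right top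
   corner, 0 elsewhere. At the two corners (1,0) and (0,1) the value is e_1,
   resp. e_2, so that v - eta v is always the representative of v off the right
   and upper boundary; the value 0 at these two corners would break the relation
   between the linear system and the canonical problem (take for mesh the bottom
   and left sides of the cell). *)
Definition eta (v : 'cV[R]_2) : 'cV[R]_2 := \col_k (v k 0 == 1)%:R.

End UnitCell.

Section Sobolev.
Variable R : realType.
Local Notation mu := (@lebesgue_measure R).

(* Sobolev functions on the interval (0,l) are represented by their absolutely
   continuous representatives: g, which is determined almost everywhere, is the
   derivative of w iff w is the indefinite integral of g. *)
Definition has_deriv (l : R) (w g : R -> R) : Prop :=
  mu.-integrable `[0, l] (EFin \o g) /\
  forall s, 0 <= s <= l -> w s = w 0 + \int[mu]_(r in `[0, s]) g r.

Definition in_L2 (l : R) (g : R -> R) : Prop :=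
  measurable_fun `[0, l] g /\
  mu.-integrable `[0, l] (EFin \o (fun s => g s ^+ 2)).

Definition in_Loo (l : R) (g : R -> R) : Prop :=
  measurable_fun `[0, l] g /\
  exists C : R, {ae mu, forall s, s \in `[0, l] -> `|g s| <= C}.

End Sobolev.

Record unit_mesh (R : realType) := UnitMesh {
  nV' : nat;  (* number of vertices off the right and upper boundary *)
  nB : nat;   (* number of vertices on the right and upper boundary *)
  nE : nat;
  vert : 'I_(nV' + nB) -> 'cV[R]_2;
  len : 'I_nE -> R;
  gam : 'I_nE -> R -> 'cV[R]_2;  (* only the values on [0, len j] matter *)
  tang : 'I_nE -> R -> 'cV[R]_2; (* the tangent in the arc length parameter *)

  vert_inj : injective vert;
  vert_V' : forall i : 'I_nV', ~~ right_top (vert (lshift nB i));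
  vert_B : forall i : 'I_nB, right_top (vert (rshift nV' i));

  len_gt0 : forall j, 0 < len j;
  gam_cell : forall j s k, 0 <= s <= len j -> 0 <= gam j s k 0 <= 1;
  gam_start : forall j, exists i, gam j 0 = vert i;
  gam_end : forall j, exists i, gam j (len j) = vert i;
  gam_inj : forall j s t, 0 <= s <= len j -> 0 <= t <= len j ->
    gam j s = gam j t -> s = t;
  gam_disj : forall i j s t, i != j -> 0 < s < len i -> 0 <= t <= len j ->
    gam i s <> gam j t;

  gam_W1oo : forall j k,
    in_Loo (len j) (fun s => tang j s k 0) /\
    has_deriv (len j) (fun s => gam j s k 0) (fun s => tang j s k 0);
  gam_arclength : forall j, {ae @lebesgue_measure R, forall s,
    s \in `[0, len j] -> \sum_k tang j s k 0 ^+ 2 = 1};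

  mesh_connected : forall i i' : 'I_(nV' + nB),
    connect [rel a b | [exists j,
      ((gam j 0 == vert a) && (gam j (len j) == vert b)) ||
      ((gam j 0 == vert b) && (gam j (len j) == vert a))]] i i';

  mesh_spans : forall k : 'I_2, exists j s j' s',
    [/\ 0 <= s <= len j, 0 <= s' <= len j' & gam j' s' = gam j s + e R k];

  (* The identification of opposite points produces a graph with vertex set V':
     every vertex has a representative in V', ... *)
  per_vert : forall i : 'I_nB, exists i' : 'I_nV',
    per_eq (vert (rshift nV' i)) (vert (lshift nB i'));
  (* ... and a point in the interior of an edge is identified with another point
     only when the two edges are identified as a whole, up to orientation. *)
  per_edge : forall i j s t, 0 < s < len i -> 0 <= t <= len j ->
    per_eq (gam i s) (gam j t) -> gam i s != gam j t ->
    len i = len j /\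
    ((forall r, 0 <= r <= len i ->
        gam j r = gam i r + (gam j t - gam i s)) \/
     (forall r, 0 <= r <= len i ->
        gam j r = gam i (len i - r) + (gam j t - gam i s)))
}.

Section CanonicalProblem.
Variables (R : realType) (M : unit_mesh R).
Local Notation mu := (@lebesgue_measure R).

Definition Gamma : set 'cV[R]_2 :=
  [set y | exists j s, 0 <= s <= len (u := M) j /\ y = gam j s].

(* Integral over Gamma of a function given edgewise in the arc length
   parameter. *)
Definition intG (F : 'I_(nE M) -> R -> R) : R :=
  \sum_j \int[mu]_(s in `[0, len j]) F j s.

Definition lengthG : R := intG (fun _ _ => 1).

(* u belongs to H^1_#(Gamma_Y), and du j is its tangential derivative along the
   j-th edge. *)
Definition H1per (u : 'cV[R]_2 -> R) (du : 'I_(nE M) -> R -> R) : Prop :=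
  [/\ forall j : 'I_(nE M), in_L2 (len j) (fun s => u (gam j s)),
      forall j, in_L2 (len j) (du j),
      forall j, has_deriv (len j) (fun s => u (gam j s)) (du j),
      {within Gamma, continuous u} &
      forall y z, Gamma y -> Gamma z -> per_eq y z -> u y = u z].

Definition canonical_sol (phi : 'cV[R]_2 -> 'cV[R]_2)
    (dphi : 'I_(nE M) -> R -> 'cV[R]_2) : Prop :=
  forall k : 'I_2,
    H1per (fun y => phi y k 0) (fun j s => dphi j s k 0) /\
    forall psi dpsi, H1per psi dpsi ->
      intG (fun j s => dphi j s k 0 * dpsi j s) =
      - intG (fun j s => tang j s k 0 * dpsi j s).

Definition Ahom (dphi : 'I_(nE M) -> R -> 'cV[R]_2) : 'M[R]_2 :=
  lengthG^-1 *: \matrix_(k, l) intG (fun j s =>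
    ((tang j s + dphi j s) *m (tang j s + dphi j s)^T) k l).

End CanonicalProblem.

Section LinearSystem.
Variables (R : realType) (M : unit_mesh R).

(* The 2 x 2 blocks correspond to the pairs of rows 2i-1, 2i and of columns
   2j-1, 2j. *)
Definition dimE : nat := (\sum_(j < nE M) 2)%N.
Definition dimV' : nat := (\sum_(i < nV' M) 2)%N.

Definition incidence : 'M[R]_(dimV', dimE) :=
  \mxblock_(i < nV' M, j < nE M)
    (((per_eq (gam j (len j)) (vert (lshift (nB M) i)))%:R
     - (per_eq (gam j 0) (vert (lshift (nB M) i)))%:R)%:M : 'M[R]_2).

Definition lengths : 'M[R]_dimE := \mxdiag_(j < nE M) ((len j)%:M : 'M[R]_2).

Definition rhs : 'cV[R]_dimE :=
  \mxcol_(j < nE M) (eta (gam j (len j)) - eta (gam j 0)).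

Definition edge_part (b : 'cV[R]_dimE) (j : 'I_(nE M)) : 'cV[R]_2 :=
  submxcol (p_ := fun _ => 2%N) b j.

Definition solves (b : 'cV[R]_dimE) (Q : 'cV[R]_dimV') : Prop :=
  block_mx lengths incidence^T incidence 0 *m col_mx b Q = col_mx rhs 0.

End LinearSystem.

(* Main.v *)
Require Import Defs.
From mathcomp Require Import measurable_realfun ring lra.
Import Order.TTheory GRing.Theory Num.Theory.
Import numFieldNormedType.Exports.
Local Open Scope classical_set_scope.
Local Open Scope ring_scope.

Set Implicit Arguments.
Unset Strict Implicit.

(** The diagonal matrix L is positive definite, so a solution of the homogeneous
    system has b = 0; since (f, 0) is then orthogonal to the kernel of the
    symmetric system matrix, the system is solvable, with unique b.

    Given a solution (b, Q), the function q that takes the value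
    eta(v) - Q(v - eta v) at a vertex v and is affine with slope b_j in arc length
    along the j-th edge is well defined, and phi = q - id is continuous and
    periodic. It solves the canonical problem: the weak form reduces to
    sum_j b_j (psi(end of j) - psi(start of j)) = 0, which is the second block
    A b = 0 tested against the vertex values of psi.

    Testing the difference of two canonical solutions with itself shows that
    their tangential derivatives agree almost everywhere, so every canonical
    solution satisfies t + phi' = b_j on the j-th edge. *)

(** * Linear algebra of symmetric saddle point systems *)

Section SaddlePoint.
Variables (F : fieldType) (m n : nat) (L : 'M[F]_n) (A : 'M[F]_(m, n)).
Hypothesis L_anisotropic : forall x : 'cV[F]_n, x^T *m L *m x = 0 -> x = 0.

(** Multiplying the first block row by b^T gives b^T L b + (A b)^T Q = 0, and A b = 0 by the second
    row. *)
Lemma saddle_kernel (b : 'cV[F]_n) (Q : 'cV[F]_m) :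
  block_mx L A^T A 0 *m col_mx b Q = 0 -> b = 0.
Proof.
rewrite mul_block_col mul0mx addr0 => /eqP; rewrite col_mx_eq0.
case/andP => /eqP LbAQ /eqP Ab; apply: L_anisotropic.
have /(congr1 (mulmx b^T)) := LbAQ.
by rewrite mulmxDr !mulmxA -trmx_mul Ab trmx0 mul0mx addr0 mulmx0.
Qed.

(* The right-hand side (f, 0) is orthogonal to the kernel (0, ker A^T) of the
   symmetric matrix of the system, hence it lies in its range. *)
Lemma saddle_solvable (f : 'cV[F]_n) : L^T = L ->
  exists (b : 'cV[F]_n) (Q : 'cV[F]_m),
    block_mx L A^T A 0 *m col_mx b Q = col_mx f 0.
Proof.
move=> Lsym; set K := block_mx L A^T A 0.
have Ksym : K^T = K by rewrite tr_block_mx Lsym trmxK trmx0.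
(* [submx] speaks of row spaces; since K is symmetric, the transposed row of coefficients D is a
   solution. *)
suff /submxP[D KD] : ((col_mx f 0)^T <= K)%MS.
  exists (usubmx D^T), (dsubmx D^T).
  by rewrite vsubmxK -[col_mx f 0]trmxK KD trmx_mul Ksym.
rewrite submxE; set C := cokermx K.
(* Each column of C lies in the kernel of K, so its upper part vanishes. *)
have C0 : usubmx C = 0.
  apply/matrixP => i j; rewrite mxE.
  have Kc : K *m col_mx (col j (usubmx C)) (col j (dsubmx C)) = 0.
    by rewrite -col_col_mx vsubmxK colE mulmxA mulmx_coker mul0mx.
  have /matrixP/(_ i 0) := saddle_kernel Kc.
  by rewrite !mxE.
by rewrite tr_col_mx trmx0 -[C]vsubmxK mul_row_col C0 mulmx0 mul0mx addr0.
Qed.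

End SaddlePoint.

(** * The system of the mesh: componentwise form, existence, uniqueness of b *)

Section System.
Variables (R : realType) (M : unit_mesh R).

Definition vertex_part (Q : 'cV[R]_(dimV' M)) (i : 'I_(nV' M)) : 'cV[R]_2 :=
  submxcol (p_ := fun _ => 2%N) Q i.

(** The scalar of the (i, j) block of [incidence]; it is 0 for a loop of the periodic graph. *)
Definition inc (i : 'I_(nV' M)) (j : 'I_(nE M)) : R :=
  (per_eq (gam j (len j)) (vert (lshift (nB M) i)))%:R
  - (per_eq (gam j 0) (vert (lshift (nB M) i)))%:R.

(** The quadratic form is the sum of [len j] times the squared norm of the j-th block, with positive
    weights. *)
Lemma lengths_anisotropic (x : 'cV[R]_(dimE M)) :
  x^T *m lengths M *m x = 0 -> x = 0.
Proof.
rewrite -mulmxA -[x](submxcolK (p_ := fun _ : 'I_(nE M) => 2%N)).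
rewrite /lengths mul_mxdiag_mxcol tr_mxcol mul_mxrow_mxcol.
set y := submxcol x => /matrixP/(_ 0 0); rewrite summxE mxE => /eqP.
have yE j : (((y j)^T *m ((len j)%:M *m y j)) 0 0 : R)
    = len j * \sum_k (y j k 0) ^+ 2.
  rewrite mul_scalar_mx -scalemxAr mxE; congr (_ * _).
  by rewrite mxE; apply: eq_bigr => k _; rewrite mxE expr2.
rewrite psumr_eq0 => [/allP y0|j _]; last first.
  by rewrite yE mulr_ge0 ?(ltW (len_gt0 _))// sumr_ge0// => k _; exact: sqr_ge0.
rewrite -(mxcol0 (p_ := fun _ : 'I_(nE M) => 2%N)); apply: eq_mxcol => j.
apply/matrixP => k l; rewrite ord1 [RHS]mxE.
have := y0 j (mem_index_enum _); rewrite yE mulf_eq0 gt_eqF ?len_gt0//=.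
rewrite psumr_eq0 => [/allP/(_ k (mem_index_enum _))|i _]; last exact: sqr_ge0.
by rewrite /= sqrf_eq0 => /eqP.
Qed.

Lemma lengths_sym : (lengths M)^T = lengths M.
Proof. by rewrite tr_mxdiag; apply: eq_mxdiag => j; rewrite tr_scalar_mx. Qed.

(** All blocks are scalar matrices, so the two coordinates k decouple. Later arguments use only
    these scalar equations. *)
Lemma solvesP (b : 'cV[R]_(dimE M)) (Q : 'cV[R]_(dimV' M)) : solves b Q ->
  (forall j k, len j * edge_part b j k 0 + \sum_i inc i j * vertex_part Q i k 0
      = eta (gam j (len j)) k 0 - eta (gam j 0) k 0) /\
  (forall i k, \sum_j inc i j * edge_part b j k 0 = 0).
Proof.
rewrite /solves mul_block_col mul0mx addr0 => /eq_col_mx[bQ b0].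
rewrite -[b](submxcolK (p_ := fun _ : 'I_(nE M) => 2%N)) in bQ b0.
rewrite -[Q](submxcolK (p_ := fun _ : 'I_(nV' M) => 2%N)) in bQ.
split.
  move=> j k; move: bQ.
  rewrite /lengths /incidence /rhs tr_mxblock mul_mxdiag_mxcol.
  rewrite mxblockEh mul_mxrow_mxcol.
  under eq_bigr do rewrite mxcol_mul.
  rewrite -mxcol_sum -mxcolD => /eq_mxcolP/(_ j)/matrixP/(_ k 0).
  have -> : eta (gam j (len j)) k 0 - eta (gam j 0) k 0 =
            (eta (gam j (len j)) - eta (gam j 0)) k 0 by rewrite !mxE.
  move=> <-; rewrite [RHS]mxE mul_scalar_mx summxE.
  congr (_ + _); first by rewrite [RHS]mxE.
  apply: eq_bigr => i _.
  by rewrite tr_scalar_mx mul_scalar_mx [RHS]mxE.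
move=> i k; move: b0.
rewrite /incidence mxblockEh mul_mxrow_mxcol.
under eq_bigr do rewrite mxcol_mul.
rewrite -mxcol_sum -(mxcol0 (p_ := fun _ : 'I_(nV' M) => 2%N)).
move=> /eq_mxcolP/(_ i)/matrixP/(_ k 0).
rewrite summxE mxE => b0; rewrite -[RHS]b0; apply: eq_bigr => j _.
by rewrite mul_scalar_mx [RHS]mxE.
Qed.

Lemma solves_exists : exists (b : 'cV[R]_(dimE M)) (Q : 'cV[R]_(dimV' M)),
  solves b Q.
Proof. exact: (saddle_solvable _ lengths_anisotropic _ lengths_sym). Qed.

Lemma solves_unique (b b' : 'cV[R]_(dimE M)) (Q Q' : 'cV[R]_(dimV' M)) :
  solves b Q -> solves b' Q' -> b = b'.
Proof.
move=> bQ bQ'; apply/eqP; rewrite -subr_eq0; apply/eqP.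
apply: (saddle_kernel lengths_anisotropic (A := incidence M) (Q := Q - Q')).
by rewrite -add_col_mx -opp_col_mx mulmxBr; apply/eqP; rewrite subr_eq0 bQ bQ'.
Qed.

End System.

(** * Periodic identification of points of the unit cell *)

Section Cell.
Variable R : realType.
Implicit Types y z v w d : 'cV[R]_2.

Definition in_cell y : Prop := forall k, 0 <= y k 0 <= 1.

(** For y in the closed cell, the translate of y in [0,1)^2. *)
Definition rep y : 'cV[R]_2 := y - eta y.

Lemma repE y k : rep y k 0 = y k 0 - (y k 0 == 1)%:R.
Proof. by rewrite !mxE. Qed.

Lemma eE (k l : 'I_2) : e R k l 0 = (l == k)%:R.
Proof. by rewrite mxE andbT. Qed.

(** Within [0,1], a coordinate difference of 1 or -1 forces the values 0 and 1, both of which [rep]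
    sends to 0. *)
Lemma rep_translate y z : in_cell y -> in_cell z ->
  (forall k, [\/ z k 0 - y k 0 = 0, z k 0 - y k 0 = 1 | z k 0 - y k 0 = -1]) ->
  rep y = rep z.
Proof.
move=> cy cz yz; apply/matrixP => k l; rewrite ord1 !repE.
have := cy k; have := cz k => /andP[z0 z1] /andP[y0 y1].
case: (yz k) => zy.
- by have -> : z k 0 = y k 0 by lra.
- have -> : z k 0 = 1 by lra.
  have -> : y k 0 = 0 by lra.
  by rewrite eqxx [0 == 1]eq_sym oner_eq0 mulr1n mulr0n !subrr.
- have -> : z k 0 = 0 by lra.
  have -> : y k 0 = 1 by lra.
  by rewrite eqxx [0 == 1]eq_sym oner_eq0 mulr1n mulr0n !subrr.
Qed.

Lemma per_eq_diff y z : per_eq y z ->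
  forall k, [\/ z k 0 - y k 0 = 0, z k 0 - y k 0 = 1 | z k 0 - y k 0 = -1].
Proof.
case/or3P => [/eqP->|/existsP[l /orP[]/eqP->]|/andP[/forallP cy /forallP cz]] k.
- by constructor 1; rewrite subrr.
- rewrite mxE addrAC subrr add0r eE.
  by case: eqP => _; [constructor 2|constructor 1].
- rewrite mxE opprD addrA subrr add0r eE.
  by case: eqP => _; [constructor 3|constructor 1; rewrite oppr0].
- case/orP: (cy k) => /eqP->; case/orP: (cz k) => /eqP->;
    rewrite ?subrr ?sub0r ?subr0; by [constructor 1|constructor 2|constructor 3].
Qed.

Lemma per_eq_rep y z : in_cell y -> in_cell z -> per_eq y z -> rep y = rep z.
Proof. by move=> cy cz yz; apply: rep_translate => //; exact: per_eq_diff. Qed.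

Lemma per_eq_sym y z : per_eq y z -> per_eq z y.
Proof.
rewrite /per_eq => /or3P[/eqP->|/existsP[k h]|/andP[-> ->]].
- by rewrite eqxx.
- by apply/or3P; constructor 2; apply/existsP; exists k; rewrite orbC.
- by apply/or3P; constructor 3.
Qed.

Lemma eta_id v : ~~ right_top v -> eta v = 0.
Proof.
move/existsPn => v1; apply/matrixP => k l.
by rewrite ord1 !mxE; have := v1 k => /negbTE ->.
Qed.

Lemma per_eq_repE v w : in_cell v -> in_cell w -> ~~ right_top w ->
  per_eq v w = (rep v == w).
Proof.
move=> cv cw w1; have rw : rep w = w by rewrite /rep eta_id ?subr0.
apply/idP/eqP => [/per_eq_rep->//|<-].
have e01 (k : 'I_2) : k = 0 \/ k = 1.
  by case: k => -[|[|//]] i; [left|right]; apply/val_inj.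
(* If both coordinates are 1, v and [rep v] differ by e_1 + e_2, which only the corner clause of
   [per_eq] covers. One coordinate equal to 1 gives a translation by one basis vector, none gives
   equality. *)
have [v0|v0] := eqVneq (v 0 0) 1; have [v1|v1] := eqVneq (v 1 0) 1.
- apply/or3P; constructor 3; apply/andP; split; apply/forallP => k.
    by case: (e01 k) => ->; rewrite ?v0 ?v1 eqxx orbT.
  by rewrite repE; case: (e01 k) => ->; rewrite ?v0 ?v1 eqxx subrr eqxx.
- apply/or3P; constructor 2; apply/existsP; exists 0; apply/orP; right.
  apply/eqP/matrixP => k l; rewrite ord1 mxE repE eE.
  by case: (e01 k) => ->; rewrite ?v0 ?(negbTE v1) ?eqxx/=; ring.
- apply/or3P; constructor 2; apply/existsP; exists 1; apply/orP; right.
  apply/eqP/matrixP => k l; rewrite ord1 mxE repE eE.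
  by case: (e01 k) => ->; rewrite ?v1 ?(negbTE v0) ?eqxx/=; ring.
- apply/or3P; constructor 1; apply/eqP/matrixP => k l; rewrite ord1 repE.
  by case: (e01 k) => ->; rewrite ?(negbTE v1) ?(negbTE v0) subr0.
Qed.

End Cell.

(** * Vertices of the mesh and their representatives *)

Section Mesh.
Variables (R : realType) (M : unit_mesh R).
Implicit Types (i j : 'I_(nE M)) (s t : R).

Lemma param_start j : 0 <= (0 : R) <= len j.
Proof. by rewrite lexx ltW// len_gt0. Qed.

Lemma param_end j : 0 <= len j <= len j.
Proof. by rewrite lexx ltW// len_gt0. Qed.

Lemma gam_in_cell j s : 0 <= s <= len j -> in_cell (gam j s).
Proof. by move=> js k; exact: gam_cell. Qed.

Definition endpoint (y : 'cV[R]_2) : Prop :=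
  exists j, y = gam j 0 \/ y = gam j (len j).

Lemma endpoint_Gamma y : endpoint y -> Gamma M y.
Proof.
case=> j [->|->]; first by exists j, 0; rewrite param_start.
by exists j, (len j); rewrite param_end.
Qed.

Lemma Gamma_in_cell y : Gamma M y -> in_cell y.
Proof. by case=> j [s [js ->]]; exact: gam_in_cell. Qed.

(* An edge has two distinct end vertices, so that v is joined to a vertex other
   than itself. *)
Lemma vert_endpoint j (v : 'I_(nV' M + nB M)) : endpoint (vert v).
Proof.
have [a ja] := gam_start j; have [b jb] := gam_end j.
have [c vc] : exists c, v != c.
  have [va|] := eqVneq v a; last by exists a.
  exists b; apply: contraTneq (len_gt0 j) => vb.
  suff <- : 0 = len j by rewrite ltxx.
  by apply: (gam_inj (param_start j) (param_end j)); rewrite ja jb -va vb.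
have /connectP[p] := mesh_connected v c.
case: p => [_ /= cv|x p /= /andP[/existsP[i vx] _] _].
  by rewrite cv eqxx in vc.
exists i; move: vx => /orP[]/andP[/eqP h1 /eqP h2]; first by left; rewrite h1.
by right; rewrite h2.
Qed.

(** A vertex of V' represents itself; for the others [per_vert] supplies a vertex of V', which
    [per_eq_repE] identifies with [rep y]. *)
Lemma endpoint_rep y : endpoint y ->
  exists i : 'I_(nV' M), rep y = vert (lshift (nB M) i).
Proof.
move=> ey; have cy := Gamma_in_cell (endpoint_Gamma ey).
have [j [v yv]] : exists (j : 'I_(nE M)) (v : 'I_(nV' M + nB M)), y = vert v.
  case: ey => j ey; exists j.
  case: ey => ->; [exact: gam_start|exact: gam_end].
have cv w := Gamma_in_cell (endpoint_Gamma (vert_endpoint j w)).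
case: (splitP v) => i vi.
  exists i; have -> : lshift (nB M) i = v by apply/val_inj.
  have vE : v = lshift (nB M) i by apply/val_inj.
  by rewrite yv /rep vE eta_id ?subr0//; exact: vert_V'.
have vE : v = rshift (nV' M) i by apply/val_inj.
have [i' yi'] := per_vert i; exists i'.
by move: yi'; rewrite -vE -yv per_eq_repE ?vert_V'// => /eqP.
Qed.

Lemma per_eq_vert y (i : 'I_(nV' M)) : endpoint y ->
  per_eq y (vert (lshift (nB M) i)) = (rep y == vert (lshift (nB M) i)).
Proof.
move=> ey; have [j _] := ey.
have cv := Gamma_in_cell (endpoint_Gamma (vert_endpoint j (lshift (nB M) i))).
by rewrite per_eq_repE ?vert_V'//; exact: (Gamma_in_cell (endpoint_Gamma ey)).
Qed.

(** Since [vert] is injective, exactly one indicator is 1, the one at [rep y]. This links values of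
    periodic functions at edge ends to the incidence matrix. *)
Lemma per_fun_endpoint (u : 'cV[R]_2 -> R) y :
  (forall y z, Gamma M y -> Gamma M z -> per_eq y z -> u y = u z) ->
  endpoint y ->
  u y = \sum_i (per_eq y (vert (lshift (nB M) i)))%:R
              * u (vert (lshift (nB M) i)).
Proof.
move=> uper ey; have [j _] := ey.
have [i yi] := endpoint_rep ey.
rewrite (bigD1 i)//= big1 => [|i' ii']; last first.
  rewrite per_eq_vert// yi (inj_eq (@vert_inj _ M)) (inj_eq (@lshift_inj _ _)).
  by rewrite eq_sym (negbTE ii') mul0r.
rewrite per_eq_vert// yi eqxx mul1r addr0.
apply: uper; [exact: endpoint_Gamma|exact/endpoint_Gamma/vert_endpoint|].
by rewrite per_eq_vert// yi.
Qed.

End Mesh.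

(** * Square integrable functions and weak derivatives on an interval *)

Section Interval.
Variables (R : realType) (l : R).
Local Notation mu := (@lebesgue_measure R).
Local Notation D := (`[0, l]%classic : set R).
Implicit Types f g w : R -> R.

Lemma aeS (P Q : R -> Prop) : (forall s, P s -> Q s) ->
  {ae mu, forall s, P s} -> {ae mu, forall s, Q s}.
Proof.
move=> PQ [N [mN N0 PN]]; exists N; split => // s nQ.
by apply: PN; apply: contra_not nQ; exact: PQ.
Qed.

Lemma ae_le_integrable f g : measurable_fun D f -> mu.-integrable D (EFin \o g) ->
  {ae mu, forall s, D s -> `|f s| <= `|g s|} -> mu.-integrable D (EFin \o f).
Proof.
move=> mf /integrableP[mg goo] fg; apply/integrableP; split.
  exact/measurable_EFinP.
apply: le_lt_trans goo; apply: ae_ge0_le_integral => //.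
- by apply: measurableT_comp => //; exact/measurable_EFinP.
- exact: measurableT_comp.
Qed.

Lemma itv_finite : (mu D < +oo)%E.
Proof.
by rewrite lebesgue_measure_itv/=; case: ifPn => // _; rewrite -EFinB ltry.
Qed.

Lemma integrable_cst (c : R) : mu.-integrable D (EFin \o cst c).
Proof.
apply: measurable_bounded_integrable => //; first exact: itv_finite.
exact: bounded_cst.
Qed.

Lemma ler_norm_mul_sqr (a b : R) : `|a * b| <= `|a ^+ 2 + b ^+ 2|.
Proof.
rewrite [leRHS]ger0_norm ?addr_ge0 ?sqr_ge0// ler_norml.
by have := sqr_ge0 (a - b); have := sqr_ge0 (a + b); nra.
Qed.

(** The domination |f g| <= f^2 + g^2 replaces the Cauchy-Schwarz inequality. *)
Lemma in_L2_mul f g : in_L2 l f -> in_L2 l g ->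
  mu.-integrable D (EFin \o (fun s => f s * g s)).
Proof.
move=> [mf if2] [mg ig2].
apply: (le_integrable _ _ _ (integrableD _ if2 ig2)) => //.
  by apply/measurable_EFinP; exact: measurable_funM.
by move=> s _ /=; rewrite lee_fin ler_norm_mul_sqr.
Qed.

Lemma in_Loo_L2 f : in_Loo l f -> in_L2 l f.
Proof.
move=> [mf [C fC]]; split => //.
apply: (@ae_le_integrable _ (cst (C ^+ 2))).
- exact: measurable_funX.
- exact: integrable_cst.
apply: aeS fC => s fC sD; rewrite /= !normrX.
by rewrite lerXn2r ?nnegrE ?normr_ge0// (le_trans (fC sD)) ?ler_norm.
Qed.

Lemma in_L2_cst (c : R) : in_L2 l (cst c).
Proof. by split=> //; exact: (integrable_cst (c ^+ 2)). Qed.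

Lemma in_L2B f g : in_L2 l f -> in_L2 l g -> in_L2 l (fun s => f s - g s).
Proof.
move=> Lf Lg; have ifg := in_L2_mul Lf Lg; case: Lf Lg => mf if2 [mg ig2].
split; first exact: measurable_funB.
have := integrableB _ (integrableD _ if2 ig2) (integrableZl _ 2 ifg).
move=> /(_ (measurable_itv _) (measurable_itv _) (measurable_itv _)).
apply: eq_integrable => // s _ /=.
by rewrite -!EFinD; congr EFin; ring.
Qed.

Lemma in_L2_bounded f : measurable_fun D f ->
  (exists C, forall s, D s -> `|f s| <= C) -> in_L2 l f.
Proof.
move=> mf [C fC]; apply: in_Loo_L2; split => //.
by exists C; apply: aeW => s sl; exact: fC.
Qed.

Lemma has_deriv_continuous w g : 0 <= l -> has_deriv l w g ->
  {within D, continuous w}.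
Proof.
move=> l0 [ig wE].
have cw : {within D, continuous (fun s => w 0 + \int[mu]_(r in `[0, s]) g r)}.
  move=> s; apply: cvgD; first exact: cvg_cst.
  exact: (parameterized_integral_continuous l0 ig).
apply: subspace_eq_continuous cw => s; rewrite inE/= in_itv/= => sl.
by rewrite /from_subspace (wE s sl).
Qed.

Lemma has_derivB w g v h : has_deriv l w g -> has_deriv l v h ->
  has_deriv l (fun s => w s - v s) (fun s => g s - h s).
Proof.
move=> [ig wE] [ih vE]; split.
  by apply: (integrableB _ ig ih).
move=> s /[dup] sl /andP[s0 sl']; rewrite RintegralB//.
- by rewrite wE// vE//; ring.
- by apply: integrableS ig => //; apply: subset_itvl; rewrite bnd_simp.
- by apply: integrableS ih => //; apply: subset_itvl; rewrite bnd_simp.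
Qed.

Lemma has_deriv_affine (a b : R) : has_deriv l (fun s => a + s * b) (cst b).
Proof.
split; first exact: integrable_cst.
move=> s /andP[s0 _]; rewrite Rintegral_cst//= lebesgue_measure_itv/= lte_fin.
case: ltP => [_|s0']; first by rewrite sube0 /=; ring.
have -> : s = 0 by apply/eqP; rewrite eq_le s0 s0'.
by rewrite /=; ring.
Qed.

Lemma has_deriv_eq w v g : (forall s, 0 <= s <= l -> w s = v s) -> 0 <= l ->
  has_deriv l w g -> has_deriv l v g.
Proof.
move=> wv l0 [ig wE]; split => // s sl.
by rewrite -(wv s sl) -(wv 0) ?lexx// (wE s sl).
Qed.

Lemma has_deriv_end w g : 0 <= l -> has_deriv l w g ->
  \int[mu]_(s in D) g s = w l - w 0.
Proof. by move=> l0 [_ ->]; rewrite ?lexx ?l0//; ring. Qed.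

Lemma in_L2_eq0 f : in_L2 l f -> \int[mu]_(s in D) f s ^+ 2 = 0 ->
  ae_eq mu D f (cst 0).
Proof.
move=> [mf if2] f0.
have mf2 : measurable_fun D (EFin \o (fun s => f s ^+ 2)).
  by apply/measurable_EFinP; exact: measurable_funX.
have : (\int[mu]_(s in D) `|(f s ^+ 2)%:E|)%E = 0.
  transitivity (\int[mu]_(s in D) f s ^+ 2)%:E; last by rewrite f0.
  rewrite fineK; last exact: integrable_fin_num.
  by apply: eq_integral => s _; rewrite gee0_abs// lee_fin sqr_ge0.
move=> abs0; have := (proj1 (ae_eq_integral_abs mu (measurable_itv _) mf2)) abs0.
apply: aeS => s h sD.
by have /eqP := h sD; rewrite eqe sqrf_eq0 => /eqP.
Qed.

Lemma Rintegral_ae_eq (E : set R) f g : measurable E ->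
  measurable_fun E f -> measurable_fun E g -> ae_eq mu E f g ->
  \int[mu]_(s in E) f s = \int[mu]_(s in E) g s.
Proof.
move=> mE mf mg fg; congr fine; apply: ae_eq_integral => //.
- exact/measurable_EFinP.
- exact/measurable_EFinP.
- by apply: aeS fg => s fg /fg ->.
Qed.

Lemma has_deriv_ae0 w g : has_deriv l w g -> ae_eq mu D g (cst 0) ->
  forall s, 0 <= s <= l -> w s = w 0.
Proof.
move=> [ig wE] g0 s /[dup] sl /andP[s0 sl']; rewrite wE//.
have sD : (`[0, s] : set R) `<=` D by apply: subset_itvl; rewrite bnd_simp.
rewrite (@Rintegral_ae_eq _ _ (cst 0))//.
- by rewrite Rintegral_cst// mul0r addr0.
- apply/measurable_EFinP; apply: (measurable_int mu).
  exact: integrableS ig.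
- by apply: aeS g0 => t h /sD/h.
Qed.

End Interval.

(** * Continuity on finite unions of compact images *)

Lemma continuous_mx (T U : topologicalType) (m n : nat) (f : T -> 'M[U]_(m, n)) :
  (forall i j, continuous (fun x => f x i j)) -> continuous f.
Proof.
move=> cf x A [P nP PA].
suff : \forall y \near x, forall i j, P i j (f y i j).
  by apply: filterS => y /PA.
by apply: filter_forall => i; apply: filter_forall => j; exact: cf (nP i j).
Qed.

Lemma compact_within_preimage (T U : topologicalType) (K : set T) (f : T -> U)
    (C : set U) :
  compact K -> {within K, continuous f} -> closed C -> compact (K `&` f @^-1` C).
Proof.
move=> cK /continuous_closedP/(_ C) + cC => /(_ cC)/closed_subspaceP[V cV VE].
by rewrite setIC -VE setIC; exact: compact_closedI.
Qed.

(* A closed set has as preimage a finite union of images of compact sets. *)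
Lemma within_bigcup_continuous (I : finType) (S T U : topologicalType)
    (K : I -> set S) (g : I -> S -> T) (u : T -> U) :
  hausdorff_space T -> (forall i, compact (K i)) ->
  (forall i, {within K i, continuous (g i)}) ->
  (forall i, {within K i, continuous (u \o g i)}) ->
  {within \bigcup_i (g i @` K i), continuous u}.
Proof.
move=> hT cK cg cu; apply/continuous_closedP => C cC; apply/closed_subspaceP.
exists (\bigcup_i (g i @` (K i `&` (u \o g i) @^-1` C))).
  apply: closed_bigcup; first exact: finite_finset.
  move=> i _; apply: compact_closed => //; apply: continuous_compact.
    by apply: continuous_subspaceW (cg i) => s [].
  exact: compact_within_preimage.
apply/seteqP; split=> y [].
  by move=> [i _ [s [Ks Cs] <-]] ?; split.
by move=> /= Cy [i _ [s Ks ys]]; split; exists i => //; exists s => //;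
  split => //=; rewrite ys.
Qed.

Lemma continuous_in_L2 (R : realType) (l : R) (f : R -> R) :
  {within `[0, l], continuous f} -> in_L2 l f.
Proof.
move=> cf; apply: in_L2_bounded.
  exact: subspace_continuous_measurable_fun.
have /compact_bounded[B [_ fB]] := continuous_compact cf (@segment_compact _ _ _).
(* Boundedness is available only for constants strictly above B, hence B + 1. *)
by exists (B + 1) => s sl; apply: fB; [rewrite ltrDl|exists s].
Qed.

(** * Periodic Sobolev functions on the mesh and uniqueness for the canonical problem *)

Section H1.
Variables (R : realType) (M : unit_mesh R).
Local Notation mu := (@lebesgue_measure R).
Implicit Types (i j : 'I_(nE M)) (s t : R).

Lemma gam_continuous j : {within `[0, len j], continuous (gam j)}.
Proof.
apply: continuous_mx => k l; rewrite ord1.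
have [_] := gam_W1oo j k; apply: has_deriv_continuous.
exact: ltW (len_gt0 j).
Qed.

(** Gamma is a finite union of compact arcs, and u is a function of the point, so its values along
    different edges already match at vertices. *)
Lemma within_Gamma_continuous (u : 'cV[R]_2 -> R) :
  (forall j, {within `[0, len j], continuous (u \o gam j)}) ->
  {within Gamma M, continuous u}.
Proof.
move=> cu; rewrite [Gamma M](_ : _ =
    \bigcup_(j in [set: 'I_(nE M)]) (gam j @` `[0, len j])).
  apply: within_bigcup_continuous; [exact: norm_hausdorff| | |exact: cu].
    by move=> j; exact: segment_compact.
  exact: gam_continuous.
apply/seteqP; split=> y.
  by move=> [j [s [sl ->]]]; exists j => //; exists s => //=; rewrite in_itv.
by move=> [j _ [s /=]]; rewrite in_itv/= => sl <-; exists j, s.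
Qed.

Lemma tang_L2 j k : in_L2 (len j) (fun s => tang j s k 0).
Proof. by apply: in_Loo_L2; have [] := gam_W1oo j k. Qed.

Lemma H1perB u du v dv : H1per (M := M) u du -> H1per v dv ->
  H1per (fun y => u y - v y) (fun j s => du j s - dv j s).
Proof.
move=> [u1 u2 u3 u4 u5] [v1 v2 v3 v4 v5]; split.
- by move=> j; exact: in_L2B.
- by move=> j; exact: in_L2B.
- by move=> j; exact: (has_derivB (u3 j) (v3 j)).
- by move=> y; apply: cvgB; [exact: u4|exact: v4].
- by move=> y z Gy Gz yz; rewrite (u5 y z)// (v5 y z).
Qed.

Lemma intGB F G :
  (forall j, mu.-integrable `[0, len j] (EFin \o F j)) ->
  (forall j, mu.-integrable `[0, len j] (EFin \o G j)) ->
  intG (fun j s => F j s - G j s) = intG (M := M) F - intG G.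
Proof.
move=> iF iG; rewrite /intG -sumrB; apply: eq_bigr => j _.
by rewrite RintegralB.
Qed.

Lemma H1per_ae0 u du : H1per (M := M) u du ->
  intG (fun j s => du j s ^+ 2) = 0 ->
  forall j, ae_eq mu `[0, len j]%classic (du j) (cst 0) /\
    forall s, 0 <= s <= len j -> u (gam j s) = u (gam j 0).
Proof.
move=> [_ Ldu deru _ _] /eqP; rewrite psumr_eq0 => [/allP du0 j|j _]; last first.
  by apply: Rintegral_ge0 => s _; exact: sqr_ge0.
have /eqP duj0 := du0 j (mem_index_enum _).
have aej := in_L2_eq0 (Ldu j) duj0.
by split=> //; exact: has_deriv_ae0 (deru j) aej.
Qed.

Lemma canonical_sol_unique phi dphi phi' dphi' :
  canonical_sol (M := M) phi dphi -> canonical_sol phi' dphi' ->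
  forall j k,
    ae_eq mu `[0, len j]%classic (fun s => dphi j s k 0 - dphi' j s k 0)
      (cst 0) /\
    forall s, 0 <= s <= len j ->
      phi (gam j s) k 0 - phi' (gam j s) k 0 =
      phi (gam j 0) k 0 - phi' (gam j 0) k 0.
Proof.
move=> sol sol' j k; have [H weak] := sol k; have [H' weak'] := sol' k.
have HB := H1perB H H'.
apply: (H1per_ae0 HB).
case: (H) (H') HB => [_ L _ _ _] [_ L' _ _ _] HB; have [_ LB _ _ _] := HB.
(* The squared difference is split into the left-hand sides of the two weak forms, both tested with
   the difference; their right-hand sides coincide. *)
transitivity (intG (fun j s => dphi j s k 0 * (dphi j s k 0 - dphi' j s k 0)
    - dphi' j s k 0 * (dphi j s k 0 - dphi' j s k 0))).
  by apply: eq_bigr => i _; apply: eq_Rintegral => s _; ring.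
rewrite intGB; first by rewrite (weak _ _ HB) (weak' _ _ HB) subrr.
- by move=> i; exact: (in_L2_mul (L i) (LB i)).
- by move=> i; exact: (in_L2_mul (L' i) (LB i)).
Qed.

End H1.

(** * Construction of a canonical solution from a solution of the linear system *)

Section Potential.
Variables (R : realType) (M : unit_mesh R).
Variables (b : 'cV[R]_(dimE M)) (Q : 'cV[R]_(dimV' M)).
Hypothesis bQ : solves b Q.
Local Notation mu := (@lebesgue_measure R).
Implicit Types (i j : 'I_(nE M)) (s t : R) (k : 'I_2).

(* The vertex values of q = phi + id; with L b + A^T Q = f the components of Q
   are the values -q(v_i). *)
Definition vertex_pot (v : 'cV[R]_2) k : R :=
  eta v k 0 - \sum_i (per_eq v (vert (lshift (nB M) i)))%:R * vertex_part Q i k 0.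

(** The restriction of phi = q - id to the j-th edge, with q affine of slope b_j from its start
    value. *)
Definition edge_pot j s : 'cV[R]_2 :=
  \col_k (vertex_pot (gam j 0) k + s * edge_part b j k 0 - gam j s k 0).

Lemma edge_potE j s k : edge_pot j s k 0 =
  vertex_pot (gam j 0) k + s * edge_part b j k 0 - gam j s k 0.
Proof. exact: mxE. Qed.

(** [xget] selects a value read off some edge through y, and 0 off Gamma; independence of the edge
    is shown in [potential_gam]. *)
Definition potential (y : 'cV[R]_2) : 'cV[R]_2 :=
  xget 0 [set p | exists j s,
    [/\ 0 <= s <= len j, y = gam j s & p = edge_pot j s]].

Definition dpotential j s : 'cV[R]_2 := edge_part b j - tang j s.

(** The j-th row of L b + A^T Q = f: the affine function started at one end of the edge reaches the
    value assigned to the other. *)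
Lemma vertex_pot_end j k :
  vertex_pot (gam j (len j)) k =
  vertex_pot (gam j 0) k + len j * edge_part b j k 0.
Proof.
have [/(_ j k) h _] := solvesP bQ.
have -> : len j * edge_part b j k 0 = eta (gam j (len j)) k 0 - eta (gam j 0) k 0
    - \sum_i inc i j * vertex_part Q i k 0 by rewrite -h; ring.
have -> : \sum_i inc i j * vertex_part Q i k 0 =
    \sum_i (per_eq (gam j (len j)) (vert (lshift (nB M) i)))%:R
           * vertex_part Q i k 0
    - \sum_i (per_eq (gam j 0) (vert (lshift (nB M) i)))%:R * vertex_part Q i k 0.
  by rewrite -sumrB; apply: eq_bigr => i _; rewrite mulrBl.
by rewrite /vertex_pot; ring.
Qed.

(** The sum over Q depends on v only through [rep v], and so does eta v - v = - [rep v]. *)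
Lemma vertex_pot_per (v w : 'cV[R]_2) k : endpoint M v -> endpoint M w ->
  rep v = rep w -> vertex_pot v k - v k 0 = vertex_pot w k - w k 0.
Proof.
move=> ev ew vw; rewrite /vertex_pot.
under eq_bigr do rewrite per_eq_vert// vw -per_eq_vert//.
have /matrixP/(_ k 0) := vw; rewrite /rep ![((_ - _) : 'cV[R]_2) k 0]mxE.
rewrite ![(- _ : 'cV[R]_2) k 0]mxE => h.
set S := \sum_i _; have -> : eta v k 0 = v k 0 - (w k 0 - eta w k 0).
  by rewrite -h; ring.
by ring.
Qed.

Lemma endpoint_start j : endpoint M (gam j 0).
Proof. by exists j; left. Qed.

Lemma endpoint_end j : endpoint M (gam j (len j)).
Proof. by exists j; right. Qed.

Lemma edge_pot_start j :
  edge_pot j 0 = \col_k (vertex_pot (gam j 0) k - gam j 0 k 0).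
Proof. by apply/matrixP => k l; rewrite ord1 edge_potE [RHS]mxE mul0r addr0. Qed.

Lemma edge_pot_end j : edge_pot j (len j) =
  \col_k (vertex_pot (gam j (len j)) k - gam j (len j) k 0).
Proof.
by apply/matrixP => k l; rewrite ord1 edge_potE [RHS]mxE vertex_pot_end.
Qed.

(* The translation d maps the end vertices of edge i to those of edge j and shifts
   vertex_pot by d, which forces b_j = b_i, or b_j = - b_i when the orientations
   are opposite. *)
Lemma edge_pot_per_interior i j s t : 0 < s < len i -> 0 <= t <= len j ->
  per_eq (gam i s) (gam j t) -> edge_pot i s = edge_pot j t.
Proof.
move=> si tj per; have /andP[s0 sl] := si.
have si' : 0 <= s <= len i by rewrite !ltW.
(* An interior point of an edge lies on no other edge and has a single parameter. *)
have [eqg|neqg] := eqVneq (gam i s) (gam j t).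
  have [ij|ij] := eqVneq i j; last by case: (gam_disj ij si tj).
  by subst j; rewrite (gam_inj si' tj eqg).
have [lij] := per_edge si tj per neqg; set d := gam j t - gam i s.
have dk k : [\/ d k 0 = 0, d k 0 = 1 | d k 0 = -1].
  by have := per_eq_diff per k; rewrite !mxE.
have tr r r' k : 0 <= r <= len i -> 0 <= r' <= len j ->
    endpoint M (gam i r) -> endpoint M (gam j r') -> gam j r' = gam i r + d ->
    vertex_pot (gam j r') k = vertex_pot (gam i r) k + d k 0.
  move=> ri rj ei ej gE.
  have dE l : gam j r' l 0 - gam i r l 0 = d l 0.
    by rewrite gE ![(_ + d) _ _]mxE; ring.
  have : rep (gam i r) = rep (gam j r').
    by apply: rep_translate; [exact: gam_in_cell|exact: gam_in_cell|];
      move=> l; rewrite dE.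
  move=> /(vertex_pot_per k ei ej) h; rewrite -dE.
  by apply/eqP; rewrite -subr_eq0; apply/eqP; move: h; set x := vertex_pot _ _;
    set y := vertex_pot _ _; lra.
have l0 : len i != 0 by rewrite gt_eqF// len_gt0.
have i0 := param_start i; have il := param_end i.
have j0 := param_start j; have jl := param_end j.
have e0 := endpoint_start; have el := endpoint_end.
have tji : 0 <= t <= len i by rewrite lij.
case=> gE.
  (* Same orientation: [gE] at t and the definition of d give gam i t = gam i s. *)
  have ts : t = s.
    by apply: (gam_inj tji si'); have /eqP := gE t tji;
      rewrite /d addrCA -[X in X == _]addr0 (inj_eq (addrI _)) eq_sym;
      rewrite subr_eq0 => /eqP.
  apply/matrixP => k l; rewrite ord1 !edge_potE ts.
  have h0 := tr 0 0 k i0 j0 (e0 i) (e0 j) (gE 0 i0).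
  have hl := tr (len i) (len j) k il jl (el i) (el j).
  rewrite -lij in hl; have {}hl := hl (gE _ il).
  have bE : edge_part b j k 0 = edge_part b i k 0.
    apply: (mulfI l0); have := vertex_pot_end i k; have := vertex_pot_end j k.
    by rewrite -lij hl h0 => h1 h2; move: h1; rewrite h2; lra.
  rewrite h0 bE (gE s si') [(_ + d) _ _]mxE; ring.
(* Opposite orientation: the start of j now corresponds to the end of i. *)
have ts : len i - t = s.
  have tli : 0 <= len i - t <= len i.
    by case/andP: tji => t0 t1; rewrite subr_ge0 t1 gerBl.
  by apply: (gam_inj tli si'); have /eqP := gE t tji;
      rewrite /d addrCA -[X in X == _]addr0 (inj_eq (addrI _)) eq_sym;
      rewrite subr_eq0 => /eqP.
apply/matrixP => k l; rewrite ord1 !edge_potE.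
have h0 : vertex_pot (gam j 0) k = vertex_pot (gam i (len i)) k + d k 0.
  by apply: tr => //; rewrite gE// subr0.
have hl : vertex_pot (gam j (len j)) k = vertex_pot (gam i 0) k + d k 0.
  by apply: tr => //; rewrite -lij gE// subrr.
have bE : edge_part b j k 0 = - edge_part b i k 0.
  apply: (mulfI l0); have := vertex_pot_end i k; have := vertex_pot_end j k.
  by rewrite hl h0 -lij => h1 h2; move: h1; rewrite h2; lra.
rewrite h0 bE (gE t tji) [(_ + d) _ _]mxE vertex_pot_end ts -ts; ring.
Qed.

(** If either parameter is interior, the previous lemma applies up to symmetry; otherwise both
    values are vertex values, which are periodic. *)
Lemma edge_pot_per i j s t : 0 <= s <= len i -> 0 <= t <= len j ->
  per_eq (gam i s) (gam j t) -> edge_pot i s = edge_pot j t.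
Proof.
have cases (x : R) (m : 'I_(nE M)) : 0 <= x <= len m ->
    0 < x < len m \/ (x = 0 \/ x = len m).
  case/andP; rewrite !le_eqVlt => /orP[/eqP<-|x0]; first by right; left.
  by case/orP => [/eqP->|xl]; [right; right|left; apply/andP].
move=> si tj per; case: (cases s i si) => [?|se].
  exact: edge_pot_per_interior.
case: (cases t j tj) => [?|te].
  by apply/esym/edge_pot_per_interior => //; exact: per_eq_sym.
have ends (x : R) m : x = 0 \/ x = len m -> endpoint M (gam m x) /\
    edge_pot m x = \col_k (vertex_pot (gam m x) k - gam m x k 0).
  case=> ->; split; [exact: endpoint_start|exact: edge_pot_start|
                     exact: endpoint_end|exact: edge_pot_end].
have [ei ->] := ends _ _ se; have [ej ->] := ends _ _ te.
apply/matrixP => k l; rewrite !mxE; apply: vertex_pot_per => //.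
by apply: per_eq_rep => //; exact: gam_in_cell.
Qed.

Lemma potential_gam j s : 0 <= s <= len j -> potential (gam j s) = edge_pot j s.
Proof.
move=> sj; apply: xget_unique; first by exists j, s.
move=> _ [i [t [ti gE ->]]]; apply: edge_pot_per => //.
by rewrite /per_eq gE eqxx.
Qed.

Lemma potential_gamE j s k : 0 <= s <= len j ->
  potential (gam j s) k 0 =
  vertex_pot (gam j 0) k + s * edge_part b j k 0 - gam j s k 0.
Proof. by move=> sj; rewrite potential_gam// edge_potE. Qed.

Lemma dpotentialE j s k : dpotential j s k 0 = edge_part b j k 0 - tang j s k 0.
Proof. by rewrite [LHS]mxE; congr (_ + _); exact: mxE. Qed.

Lemma potential_H1per k :
  H1per (fun y => potential y k 0) (fun j s => dpotential j s k 0).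
Proof.
have dE : (fun j s => dpotential j s k 0) =
    (fun j s => cst (edge_part b j k 0) s - tang j s k 0).
  by apply/funext => j; apply/funext => s; rewrite dpotentialE.
have der j : has_deriv (len j) (fun s => potential (gam j s) k 0)
    (fun s => cst (edge_part b j k 0) s - tang j s k 0).
  have [_ dg] := gam_W1oo j k.
  have := has_derivB (has_deriv_affine _ (vertex_pot (gam j 0) k)
    (edge_part b j k 0)) dg.
  apply: has_deriv_eq; last exact: ltW (len_gt0 j).
  by move=> s sj; rewrite potential_gamE.
have cont j := has_deriv_continuous (ltW (len_gt0 j)) (der j).
rewrite dE; split => //.
- by move=> j; exact: continuous_in_L2.
- by move=> j; apply: in_L2B; [exact: in_L2_cst|exact: tang_L2].
- exact: within_Gamma_continuous.
- move=> _ _ [i [s [si ->]]] [j [t [tj ->]]] per.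
  by rewrite !potential_gam// (edge_pot_per si tj per).
Qed.

(** Expanding the jumps of psi in incidence coefficients and exchanging the sums leaves the vertex
    values of psi paired with A b = 0. *)
Lemma kirchhoff (psi : 'cV[R]_2 -> R) k :
  (forall y z, Gamma M y -> Gamma M z -> per_eq y z -> psi y = psi z) ->
  \sum_j edge_part b j k 0 * (psi (gam j (len j)) - psi (gam j 0)) = 0.
Proof.
move=> psiper; have [_ b0] := solvesP bQ.
have jump j : psi (gam j (len j)) - psi (gam j 0) =
    \sum_i inc i j * psi (vert (lshift (nB M) i)).
  rewrite (per_fun_endpoint psiper (endpoint_end j)).
  rewrite (per_fun_endpoint psiper (endpoint_start j)) -sumrB.
  by apply: eq_bigr => i _; rewrite mulrBl.
under eq_bigr do rewrite jump mulr_sumr.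
rewrite exchange_big/= big1// => i _.
transitivity (psi (vert (lshift (nB M) i)) * \sum_j inc i j * edge_part b j k 0).
  by rewrite mulr_sumr; apply: eq_bigr => j _; ring.
by rewrite b0 mulr0.
Qed.

Lemma potential_canonical : canonical_sol potential dpotential.
Proof.
move=> k; split; first exact: potential_H1per.
move=> psi dpsi [_ Ldpsi der _ per].
transitivity (intG (fun j s => edge_part b j k 0 * dpsi j s
    - tang j s k 0 * dpsi j s)).
  apply: eq_bigr => j _; apply: eq_Rintegral => s _.
  by rewrite dpotentialE mulrBl.
rewrite intGB => [|j|j].
- rewrite [X in X - _](_ : _ = 0) ?sub0r// -[RHS](kirchhoff k per).
  apply: eq_bigr => j _; rewrite RintegralZl//.
    by rewrite (has_deriv_end (ltW (len_gt0 j)) (der j)).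
  by have [] := der j.
- exact: (in_L2_mul (in_L2_cst _ _) (Ldpsi j)).
- exact: (in_L2_mul (tang_L2 j k) (Ldpsi j)).
Qed.

(** * Slopes and homogenized tensor of an arbitrary canonical solution *)

Section CanonicalSolution.
Variables (phi : 'cV[R]_2 -> 'cV[R]_2) (dphi : 'I_(nE M) -> R -> 'cV[R]_2).
Hypothesis sol : canonical_sol phi dphi.

Lemma canonical_sol_derive j s k : 0 < s < len j ->
  is_derive s 1 (fun r : R => (phi (gam j r) + gam j r) k 0) (edge_part b j k 0).
Proof.
move=> sj; have [_ phiE] := canonical_sol_unique sol potential_canonical j k.
(* On this edge phi is [potential] plus the constant c, so phi + id is affine with slope b_j. *)
set c := phi (gam j 0) k 0 - potential (gam j 0) k 0 in phiE.
have affine (a : R) : is_derive s 1 (fun r : R => a + r * edge_part b j k 0)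
    (edge_part b j k 0).
  by apply: is_derive_eq; rewrite scaler0 !add0r mul1r; exact: mulr1.
apply: near_eq_is_derive (affine (c + vertex_pot (gam j 0) k)).
have : s \in `]0, len j[ by rewrite in_itv.
move=> /near_in_itvoo; apply: filterS => r; rewrite in_itv/= => rj.
have rj' : 0 <= r <= len j by case/andP: rj => ? ?; rewrite !ltW.
rewrite [RHS]mxE; have := phiE r rj'; rewrite potential_gamE//.
by set x := phi _ _ _; set y := gam _ _ _ _; lra.
Qed.

Lemma Ahom_canonical_sol : Ahom dphi = (lengthG M)^-1 *:
  \sum_(j < nE M) len j *: (edge_part b j *m (edge_part b j)^T).
Proof.
congr (_ *: _); apply/matrixP => k l; rewrite mxE summxE; apply: eq_bigr => j _.
have mulE (x : 'cV[R]_2) : (x *m x^T) k l = x k 0 * x l 0.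
  by rewrite mxE big_ord_recl big_ord0 addr0 mxE.
have [ak _] := canonical_sol_unique sol potential_canonical j k.
have [al _] := canonical_sol_unique sol potential_canonical j l.
have mtd (m : 'I_2) :
    measurable_fun `[0, len j] (fun s => tang j s m 0 + dphi j s m 0).
  have [[_ Ld _ _ _] _] := sol m; apply: measurable_funD.
    by have [] := tang_L2 j m.
  by have [] := Ld j.
transitivity (\int[mu]_(s in `[0, len j])
    ((tang j s k 0 + dphi j s k 0) * (tang j s l 0 + dphi j s l 0))).
  apply: eq_Rintegral => s _; rewrite mulE; congr (_ * _); exact: mxE.
rewrite (@Rintegral_ae_eq _ _ _ (cst (edge_part b j k 0 * edge_part b j l 0)))//.
- rewrite Rintegral_cst//= lebesgue_measure_itv/= lte_fin len_gt0/=.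
  by rewrite [RHS]mxE mulE subr0 mulrC.
- exact: measurable_funM.
(* Off the union of the exceptional null sets of coordinates k and l, both factors of the integrand
   are the constants given by b_j. *)
- case: ak al => N [mN N0 kN] [N' [mN' N'0 lN]]; exists (N `|` N'); split.
  + exact: measurableU.
  + exact: null_set_setU.
  + move=> s /= h; apply: contrapT => /not_orP[nN nN']; apply: h => sj /=.
    have sk : dphi j s k 0 - dpotential j s k 0 = 0.
      by apply: contrapT => h; apply: nN; apply: kN => /= /(_ sj).
    have sl : dphi j s l 0 - dpotential j s l 0 = 0.
      by apply: contrapT => h; apply: nN'; apply: lN => /= /(_ sj).
    by move: sk sl; rewrite !dpotentialE => sk sl; congr (_ * _); lra.
Qed.

End CanonicalSolution.

End Potential.

Unset Implicit Arguments.

(** The second clause makes the third non-vacuous. The last formula expresses the tensor through b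
    alone, so it depends neither on the choice of phi nor on Q. *)
Theorem lemma4p2 (R : realType) (M : unit_mesh R) :
  [/\ exists! b : 'cV[R]_(dimE M), exists Q : 'cV[R]_(dimV' M), solves b Q,
      exists (phi : 'cV[R]_2 -> 'cV[R]_2)
             (dphi : 'I_(nE M) -> R -> 'cV[R]_2), canonical_sol phi dphi &
      forall (b : 'cV[R]_(dimE M)) (Q : 'cV[R]_(dimV' M))
             (phi : 'cV[R]_2 -> 'cV[R]_2)
             (dphi : 'I_(nE M) -> R -> 'cV[R]_2),
        solves b Q -> canonical_sol phi dphi ->
        (forall (j : 'I_(nE M)) (s : R) (k : 'I_2), 0 < s < len j ->
           is_derive s 1 (fun r : R => (phi (gam j r) + gam j r) k 0)
             (edge_part b j k 0)) /\
        Ahom dphi = (lengthG M)^-1 *: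
          \sum_(j < nE M) len j *: (edge_part b j *m (edge_part b j)^T)].
Proof.
have [b [Q bQ]] := solves_exists M; split.
- exists b; split; first by exists Q.
  by move=> b' [Q' bQ']; exact: solves_unique bQ bQ'.
- by exists (potential b Q), (dpotential b); exact: potential_canonical.
- move=> b' Q' phi dphi bQ' sol; split.
    by move=> j s k sj; exact: (canonical_sol_derive bQ' sol k sj).
  exact: (Ahom_canonical_sol bQ' sol).
Qed.
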